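(* Let $k$ be a non-negative kernel on $I$ and $\mu$ a $\sigma$-finite Borel measure on $I$. Suppose that $c_0:=\sup_{t\in I}\int_{I(t)}k(t,s)^p\,\mu(\mathrm{d}s)$ and $$\varepsilon_0:=\lim_{\delta\downarrow0}\sup_{\substack{r,t\in I:\\ r\le t\le r+\delta}}\int_{[r,t]}k(t,s)^p\,\mu(\mathrm{d}s)$$ are finite for some $p>0$, where $I(t):=\{s\in I\,|\,s\le t\}$ for all $t\in I$. Then for every $\varepsilon>\varepsilon_0$ there is $\delta>0$ such that $$\sup_{\substack{r,t\in I:\\ r\le t\le r+m\delta}}\int_{[r,t]}\mathrm{R}_{k^p,\mu,n}(t,s)\,\mu(\mathrm{d}s)\le(nc_\varepsilon)^{m-1}\varepsilon^n$$ for all $m,n\in\mathbb{N}$ with $c_\varepsilon:=\max\{1,\frac{c_0}{\varepsilon}\}$. Moreover, the inequality remains valid if in the definitions of $c_0$ and $\varepsilon_0$ and in this inequality the suprema are replaced by essential suprema.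
   Context: $I$ is a non-degenerate interval in $\mathbb{R}$. A non-negative kernel on $I$ is a $[0,\infty]$-valued measurable function on $\{(t,s)\in I\times I: s\le t\}$. For a non-negative kernel $k$ and a $\sigma$-finite Borel measure $\mu$ on $I$ the iterated kernels are recursively defined by $\mathrm{R}_{k,\mu,1}(t,s):=k(t,s)$ and $\mathrm{R}_{k,\mu,n+1}(t,s):=\int_{[s,t]}k(t,\tilde s)\mathrm{R}_{k,\mu,n}(\tilde s,s)\,\mu(\mathrm{d}\tilde s)$; $\mathrm{R}_{k^p,\mu,n}$ is formed from the kernel $(t,s)\mapsto k(t,s)^p$. Essential suprema are with respect to $\mu$ (with respect to $\mu\otimes\mu$ for pairs $(r,t)$). *)

(* Defs.v *)
From HB Require Import structures.
From mathcomp Require Import all_boot all_order all_algebra.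
From mathcomp Require Import all_classical all_reals all_analysis.
From mathcomp Require Import measurable_realfun ess_sup_inf.

Set Implicit Arguments.
Unset Strict Implicit.
Unset Printing Implicit Defensive.

Import Order.TTheory GRing.Theory Num.Theory.
Import numFieldNormedType.Exports.

Local Open Scope classical_set_scope.
Local Open Scope ring_scope.
Local Open Scope ereal_scope.

Definition nondegenerate_interval (R : realType) (I : set R) : Prop :=
  is_interval I /\ exists a b : R, [/\ I a, I b & (a < b)%R].

(* Kernels and measures on I are represented on all of R: a kernel is
   constrained (and ever evaluated, in what follows) only on the triangle
   below, and a Borel measure on I is identified with its extension by zero,
   i.e. a Borel measure on R vanishing on the complement of I. *)
Definition triangle (R : realType) (I : set R) :
    set (measurableTypeR R * measurableTypeR R) :=
  [set ts | [/\ I ts.1, I ts.2 & (ts.2 <= ts.1)%R]].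

Definition nonneg_kernel (R : realType) (I : set R) (k : R -> R -> \bar R) :
    Prop :=
  measurable_fun (triangle I) (fun ts => k ts.1 ts.2) /\
  forall ts, triangle I ts -> 0 <= k ts.1 ts.2.

Definition kernel_pow (R : realType) (k : R -> R -> \bar R) (p : R) :
    R -> R -> \bar R :=
  fun t s => k t s `^ p.

(* Indexed from n = 1; the value at n = 0 is junk. *)
Definition iterated_kernel (R : realType) (k : R -> R -> \bar R)
    (mu : set (measurableTypeR R) -> \bar R) (n : nat) : R -> R -> \bar R :=
  iter n.-1 (fun r t s => \int[mu]_(u in `[s, t]) (k t u * r u s)) k.

Lemma iterated_kernel1 (R : realType) (k : R -> R -> \bar R)
    (mu : set (measurableTypeR R) -> \bar R) :
  iterated_kernel k mu 1 = k.
Proof. by []. Qed.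

Lemma iterated_kernelS (R : realType) (k : R -> R -> \bar R)
    (mu : set (measurableTypeR R) -> \bar R) (n : nat) (t s : R) : (0 < n)%N ->
  iterated_kernel k mu n.+1 t s =
  \int[mu]_(u in `[s, t]) (k t u * iterated_kernel k mu n u s).
Proof. by case: n. Qed.

(* Essential supremum over D of a function with values in [0, +oo]. The maximum
   with 0 only matters when mu is the zero measure, in which case the library's
   ess_sup is -oo whereas the infimum of the essential bounds in [0, +oo]
   is 0. *)
Definition ess_sup_on d (T : measurableType d) (R : realType)
    (mu : {measure set T -> \bar R}) (D : set T) (f : T -> \bar R) : \bar R :=
  maxe 0 (ess_sup mu (f \_ D)).

Definition window (R : realType) (I : set R) (delta : R) :
    set (measurableTypeR R * measurableTypeR R) :=
  [set rt | [/\ I rt.1, I rt.2 & (rt.1 <= rt.2 <= rt.1 + delta)%R]].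

Definition below_int (R : realType) (I : set R)
    (mu : set (measurableTypeR R) -> \bar R) (k : R -> R -> \bar R) (t : R) :
    \bar R :=
  \int[mu]_(s in [set s | I s /\ (s <= t)%R]) k t s.

Definition window_int (R : realType)
    (mu : set (measurableTypeR R) -> \bar R) (k : R -> R -> \bar R)
    (rt : measurableTypeR R * measurableTypeR R) : \bar R :=
  \int[mu]_(s in `[rt.1, rt.2]) k rt.2 s.

Definition sup_below (R : realType) (I : set R)
    (mu : set (measurableTypeR R) -> \bar R) (k : R -> R -> \bar R) : \bar R :=
  ereal_sup [set below_int I mu k t | t in I].

Definition sup_window (R : realType) (I : set R)
    (mu : set (measurableTypeR R) -> \bar R) (k : R -> R -> \bar R)
    (delta : R) : \bar R :=
  ereal_sup [set window_int mu k rt | rt in window I delta].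

Definition ess_sup_below (R : realType) (I : set R)
    (mu : {measure set (measurableTypeR R) -> \bar R})
    (k : R -> R -> \bar R) : \bar R :=
  ess_sup_on mu I (below_int I mu k).

Definition ess_sup_window (R : realType) (I : set R)
    (mu : {sigma_finite_measure set (measurableTypeR R) -> \bar R})
    (k : R -> R -> \bar R) (delta : R) : \bar R :=
  ess_sup_on (mu \x mu) (window I delta) (window_int mu k).

(* Main.v *)
Require Import Defs.
From HB Require Import structures.
From mathcomp Require Import all_boot all_order all_algebra.
From mathcomp Require Import all_classical all_reals all_analysis.
From mathcomp Require Import measurable_realfun ess_sup_inf.
From mathcomp Require Import ring.

Import Order.TTheory GRing.Theory Num.Theory.
Import numFieldNormedType.Exports.

Local Open Scope classical_set_scope.
Local Open Scope ring_scope.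

(** Put K = k^p and F_n(r,t) = \int_[r,t] R_n(t,s) mu(ds). Tonelli's theorem
    gives F_{n+1}(r,t) = \int_[r,t] K(t,u) F_n(r,u) mu(du). If delta is such that
    F_1 <= eps on windows of length delta, then splitting [r,t] at t - delta and
    bounding F_n(r,u) by the (m-1)- and the m-window estimates, respectively,
    yields the claim by induction on n.
    In the essential version the point is that the estimates hold for almost
    every t and then for all r: F_1(r,t) is monotone in r, so an almost sure
    bound in r extends to every r. Hence both versions are instances of
    one statement about a set P of good points t whose complement is null. *)

(** * Joint measurability and the Tonelli recursion *)

(** The integral is a section integral of [g] restricted to the measurable set of pairs [(x, u)]
    with [a x <= u <= b x], so Tonelli's theorem gives measurability in [x]. *)
Lemma measurable_integral_itv (d : measure_display) (T : measurableType d)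
    (R : realType) (mu : {sigma_finite_measure set (measurableTypeR R) -> \bar R})
    (a b : T -> R) (g : T -> R -> \bar R) :
  measurable_fun setT a -> measurable_fun setT b ->
  measurable_fun setT (fun x : T * measurableTypeR R => g x.1 x.2) ->
  (forall x u, 0 <= g x u)%E ->
  measurable_fun setT (fun x => \int[mu]_(u in `[a x, b x]) g x u)%E.
Proof.
move=> ma mb mg g0.
pose D := [set x : T * measurableTypeR R | a x.1 <= x.2 <= b x.1].
have mD : measurable D.
  have -> : D = (setT `&` [set x | (a \o fst) x <= snd x]) `&`
                (setT `&` [set x | snd x <= (b \o fst) x]).
    by rewrite !setTI; apply/seteqP; split=> x /= /andP.
  apply: measurableI; apply: measurable_fun_le => //;
    exact: measurableT_comp.
have := @measurable_fun_fubini_tonelli_F _ _ _ _ _ mu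
  ((fun x : T * measurableTypeR R => g x.1 x.2) \_ D).
rewrite (_ : fubini_F _ _ =
  (fun x => \int[mu]_(u in `[a x, b x]) g x u)%E); last first.
  apply/funext => x; rewrite /fubini_F [RHS]integral_mkcond.
  apply: eq_integral => u _; rewrite !patchE.
  suff -> : ((x, u) \in D) = (u \in [set` `[a x, b x]]) by [].
  by apply/idP/idP; rewrite !inE /D /=.
apply.
- exact: (measurable_restrictT _ mD).1 (measurable_funTS mg).
- by move=> x; rewrite patchE; case: ifP.
Qed.

Lemma iterated_kernel_ge0 (R : realType)
    (mu : {measure set (measurableTypeR R) -> \bar R})
    (k : R -> R -> \bar R) (n : nat) (t s : R) :
  (forall t s, 0 <= k t s)%E -> (0 <= iterated_kernel k mu n t s)%E.
Proof.
(* Index 0 is a second base case: the iterate there is [k] as well. *)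
move=> k0; elim: n t s => [//|[//|n] IH] t s.
by rewrite iterated_kernelS//; apply: integral_ge0 => u _; rewrite mule_ge0.
Qed.

Lemma measurable_iterated_kernel (R : realType)
    (mu : {sigma_finite_measure set (measurableTypeR R) -> \bar R})
    (k : R -> R -> \bar R) (n : nat) :
  measurable_fun [set: measurableTypeR R * measurableTypeR R]
    (fun ts => k ts.1 ts.2) ->
  (forall t s, 0 <= k t s)%E ->
  measurable_fun [set: measurableTypeR R * measurableTypeR R]
    (fun ts => iterated_kernel k mu n ts.1 ts.2).
Proof.
move=> mk k0; elim: n => [//|[//|n] IH].
under eq_fun do rewrite iterated_kernelS//.
apply: (@measurable_integral_itv _ _ _ mu snd fst
  (fun ts u => k ts.1 u * iterated_kernel k mu n.+1 u ts.2)%E) => //.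
- apply: emeasurable_funM.
  + apply: (measurableT_comp mk (g := fun x => (x.1.1, x.2))).
    by apply: measurable_fun_pair => //; exact: measurableT_comp.
  + apply: (measurableT_comp IH (g := fun x => (x.2, x.1.2))).
    by apply: measurable_fun_pair => //; exact: measurableT_comp.
- by move=> ts u; rewrite mule_ge0// iterated_kernel_ge0.
Qed.

Lemma measurable_window_int (R : realType)
    (mu : {sigma_finite_measure set (measurableTypeR R) -> \bar R})
    (k : R -> R -> \bar R) (r : R) :
  measurable_fun [set: measurableTypeR R * measurableTypeR R]
    (fun ts => k ts.1 ts.2) ->
  (forall t s, 0 <= k t s)%E ->
  measurable_fun [set: measurableTypeR R] (fun t => window_int mu k (r, t)).
Proof.
move=> mk k0.
exact: (@measurable_integral_itv _ (measurableTypeR R) _ mu (cst r) id k).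
Qed.

(** Both sides are iterated integrals of [f] restricted to the triangle [r <= s <= u <= t], once
    with [u] and once with [s] as the inner variable. *)
Lemma integral_triangle (R : realType)
    (mu : {sigma_finite_measure set (measurableTypeR R) -> \bar R})
    (f : R -> R -> \bar R) (r t : R) :
  measurable_fun [set: measurableTypeR R * measurableTypeR R]
    (fun su => f su.1 su.2) ->
  (forall s u, 0 <= f s u)%E ->
  (\int[mu]_(s in `[r, t]) \int[mu]_(u in `[s, t]) f s u =
   \int[mu]_(u in `[r, t]) \int[mu]_(s in `[r, u]) f s u)%E.
Proof.
move=> mf f0.
pose D := [set x : measurableTypeR R * measurableTypeR R |
  [/\ r <= x.1, x.1 <= x.2 & x.2 <= t]].
have mD : measurable D.
  have -> : D = (setT `&` [set x | cst r x <= fst x]) `&`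
     ((setT `&` [set x | fst x <= snd x]) `&`
      (setT `&` [set x | snd x <= cst t x])).
    rewrite !setTI; apply/seteqP; split=> x /=; first by case.
    by case=> ? [].
  by apply: measurableI; [|apply: measurableI]; apply: measurable_fun_le.
pose h := (fun x : measurableTypeR R * measurableTypeR R => f x.1 x.2) \_ D.
have h0 x : (0 <= h x)%E by rewrite /h patchE; case: ifP.
have mh : measurable_fun setT h.
  exact: (measurable_restrictT _ mD).1 (measurable_funTS mf).
have hD s u : r <= s -> s <= u -> u <= t -> h (s, u) = f s u.
  by move=> *; rewrite /h patchE mem_set.
have hND s u : ~ [/\ r <= s, s <= u & u <= t] -> h (s, u) = 0%E.
  by move=> nD; rewrite /h patchE memNset.
have E := @fubini_tonelli _ _ _ _ _ mu mu h mh h0.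
transitivity (\int[mu]_s \int[mu]_u h (s, u))%E.
  rewrite integral_mkcond; apply: eq_integral => s _; rewrite patchE.
  case: ifPn => [|/negP sD].
    rewrite inE /= in_itv /= => /andP[rs st].
    rewrite integral_mkcond; apply: eq_integral => u _.
    rewrite patchE; case: ifPn => [|/negP uD].
      by rewrite inE /= in_itv /= => /andP[su ut]; rewrite hD.
    by rewrite hND// => -[_ su ut]; apply: uD; rewrite inE /= in_itv /= su.
  rewrite (_ : (fun u => h (s, u)) = cst 0%E) ?integral0//.
  apply/funext => u; apply: hND => -[rs su ut]; apply: sD.
  by rewrite inE /= in_itv /= rs (le_trans su ut).
rewrite {}E [RHS]integral_mkcond; apply: eq_integral => u _; rewrite patchE.
case: ifPn => [|/negP uD].
  rewrite inE /= in_itv /= => /andP[ru ut].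
  rewrite [RHS]integral_mkcond; apply: eq_integral => s _.
  rewrite patchE; case: ifPn => [|/negP sD].
    by rewrite inE /= in_itv /= => /andP[rs su]; rewrite hD.
  by rewrite hND// => -[rs su _]; apply: sD; rewrite inE /= in_itv /= rs.
rewrite (_ : (fun s => h (s, u)) = cst 0%E) ?integral0//.
apply/funext => s; apply: hND => -[rs su ut]; apply: uD.
by rewrite inE /= in_itv /= ut (le_trans rs su).
Qed.

(** Insert the recursion, exchange the integrals over the triangle, and pull [k t u] out of the
    inner one. *)
Lemma window_int_iteratedS (R : realType)
    (mu : {sigma_finite_measure set (measurableTypeR R) -> \bar R})
    (k : R -> R -> \bar R) (n : nat) (r t : R) :
  measurable_fun [set: measurableTypeR R * measurableTypeR R]
    (fun ts => k ts.1 ts.2) ->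
  (forall t s, 0 <= k t s)%E -> (0 < n)%N ->
  window_int mu (iterated_kernel k mu n.+1) (r, t) =
  (\int[mu]_(u in `[r, t]) (k t u * window_int mu (iterated_kernel k mu n) (r, u)))%E.
Proof.
move=> mk k0 n0.
have mR := measurable_iterated_kernel _ mu _ n mk k0.
have R0 u s := iterated_kernel_ge0 _ mu _ n u s k0.
rewrite /window_int /=.
under eq_integral => s _ do rewrite (iterated_kernelS _ _ _ _ n0).
rewrite (integral_triangle _ mu
  (fun s u => k t u * iterated_kernel k mu n u s)%E).
- apply: eq_integral => u _; apply: ge0_integralZl => //.
  apply: measurable_funTS.
  exact: (measurableT_comp mR (pair1_measurable u)).
- apply: emeasurable_funM.
  + apply: (measurableT_comp mk (g := fun x => (t, x.2))).
    exact: measurable_fun_pair.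
  + apply: (measurableT_comp mR (g := fun x => (x.2, x.1))).
    exact: measurable_fun_pair.
- by move=> s u; rewrite mule_ge0.
Qed.

(** * Null sets in products and bounds holding almost everywhere *)

(** By uniqueness of the product measure for sigma-finite factors, the measure of a set is also the
    integral over [y] of the measures of its sections at [y]. For a null set this integral vanishes,
    so almost every section is null. *)
Lemma ae_ysection (d1 d2 : measure_display) (T1 : measurableType d1)
    (T2 : measurableType d2) (R : realType)
    (m1 : {sigma_finite_measure set T1 -> \bar R})
    (m2 : {sigma_finite_measure set T2 -> \bar R}) (Q : T1 * T2 -> Prop) :
  (\forall z \ae (m1 \x m2)%E, Q z) ->
  \forall y \ae m2, \forall x \ae m1, Q (x, y).
Proof.
move=> [N [mN N0 QN]].
have : (m1 \x^ m2)%E N = 0%E.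
  rewrite -(@product_measure_unique _ _ _ _ _ m1 m2 (m1 \x^ m2)%E)//.
  by move=> A B mA mB; exact: product_measure2E.
rewrite /product_measure2 => I0.
have : (\int[m2]_y `|(m1 \o ysection N) y| = 0)%E.
  by rewrite -I0; apply: eq_integral => y _; rewrite gee0_abs.
move/(ae_eq_integral_abs _ measurableT (measurable_fun_ysection _ mN)).
apply: filterS => y /(_ I)/= Ny0; exists (ysection N y); split => //.
  exact: measurable_ysection.
by move=> x nQ; rewrite /ysection /= inE; exact: QN.
Qed.

Lemma ae_prod_snd (d1 d2 : measure_display) (T1 : measurableType d1)
    (T2 : measurableType d2) (R : realType)
    (m1 : {measure set T1 -> \bar R})
    (m2 : {sigma_finite_measure set T2 -> \bar R}) (P : T2 -> Prop) :
  (\forall y \ae m2, P y) -> \forall z \ae (m1 \x m2)%E, P z.2.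
Proof.
move=> [N [mN N0 PN]]; exists (setT `*` N); split => //.
- exact: measurableX.
(* The first factor may have infinite total measure; the convention [+oo * 0 = 0] applies. *)
- by rewrite product_measure1E// N0 mule0.
- by move=> z nP; split => //; exact: PN.
Qed.

Lemma ge0_ae_subset_integral (d : measure_display) (T : measurableType d)
    (R : realType) (mu : {measure set T -> \bar R}) (A B : set T)
    (f : T -> \bar R) :
  measurable A -> measurable B -> measurable_fun setT f ->
  (forall x, 0 <= f x)%E -> (\forall x \ae mu, A x -> B x) ->
  (\int[mu]_(x in A) f x <= \int[mu]_(x in B) f x)%E.
Proof.
move=> mA mB mf f0 [N [mN N0 AB]].
rewrite (ge0_negligible_integral mN mA)//; last exact: measurable_funTS.
apply: ge0_subset_integral => //; first exact: measurableD.
- exact: measurable_funTS.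
- move=> x [Ax nNx]; apply: contrapT => nBx; apply: nNx; apply: AB => /=.
  by move=> /(_ Ax).
Qed.

Lemma ae_integral_itv_le (R : realType)
    (mu : {measure set (measurableTypeR R) -> \bar R})
    (f : measurableTypeR R -> \bar R) (a t : R) (e : \bar R) :
  measurable_fun setT f -> (forall x, 0 <= f x)%E -> (0 <= e)%E ->
  (\forall r \ae mu, (a <= r <= t)%R -> \int[mu]_(x in `[r, t]) f x <= e)%E ->
  (\int[mu]_(x in `[a, t]) f x <= e)%E.
Proof.
move=> mf f0 e0 ae.
pose S := [set r | a <= r <= t /\ (\int[mu]_(x in `[r, t]) f x <= e)%E].
have subint (A B : set (measurableTypeR R)) : measurable A -> measurable B ->
    A `<=` B -> (\int[mu]_(x in A) f x <= \int[mu]_(x in B) f x)%E.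
  by move=> mA mB AB; apply: ge0_subset_integral => //; exact: measurable_funTS.
(* Almost every point of [[a, t]] lies in [S], so the integral over [[a, t]] is at most the integral
   over any measurable [A] containing [S]. *)
have reduce (A : set (measurableTypeR R)) : measurable A ->
    S `<=` A -> (\int[mu]_(x in A) f x <= e)%E ->
    (\int[mu]_(x in `[a, t]) f x <= e)%E.
  move=> mA SA; apply: le_trans; apply: ge0_ae_subset_integral => //.
  apply: (@filterS _ _ (ae_filter_ringOfSetsType mu) _ _ _ ae) => r Hr; rewrite /= in_itv/= => art.
  by apply: SA; split => //; exact: Hr.
(* [a, t] minus S is null, and S is an up-set of [a, t], so it suffices to bound
   the integral over the interval from inf S to t, closed or half-open. *)
have [S0|/set0P/negP/negPn/eqP S0] := pselect (S !=set0); last first.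
  by apply: (reduce set0) => //; rewrite ?S0// integral_set0.
have Sinf : has_inf S by split => //; exists a => x [/andP[]].
have Slb x : S x -> inf S <= x by apply: ge_inf; case: Sinf.
have Sup x y : S x -> x <= y <= t -> S y.
  move=> [/andP[ax xt] xe] /andP[xy yt]; split; first by rewrite (le_trans ax).
  apply: le_trans xe; apply: subint => // z /=; rewrite !in_itv/=.
  by move=> /andP[yz ->]; rewrite (le_trans xy).
have [Sg|nSg] := pselect (S (inf S)).
  apply: (reduce `[inf S, t]%classic) => //; last by case: Sg.
  by move=> x Sx; rewrite /= in_itv/= Slb//; case: Sx => /andP[].
(* If [inf S] is not in [S], then [S] lies in []inf S, t]], the increasing union of the closed
   intervals [F i]. A nonempty [F i] starts at a point of [S], so its integral is at most [e], and
   monotone convergence passes the bound to the union. *)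
pose F i : set (measurableTypeR R) := `[inf S + i.+1%:R^-1, t]%classic.
have ndF : nondecreasing_seq F.
  move=> i j ij; apply/subsetPset => x; rewrite /F /= !in_itv/=.
  move=> /andP[ix ->]; rewrite andbT (le_trans _ ix)// lerD2l.
  by rewrite lef_pV2 ?posrE ?ler_nat.
have mF i : measurable (F i) by exact: measurable_itv.
apply: (reduce (\bigcup_i F i)); first exact: bigcup_measurable.
  move=> x Sx; have gx : inf S < x.
    by rewrite lt_neqAle Slb// andbT; apply/eqP => E; apply: nSg; rewrite E.
  have [i _ /(_ i (leqnn i)) ix] := near_infty_natSinv_lt (PosNum (eqbRL (subr_gt0 _ _) gx)).
  exists i => //; rewrite /F /= in_itv/=; case: Sx => /andP[_ ->] _.
  by rewrite andbT addrC -lerBrDr ltW.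
have cvF := @ge0_nondecreasing_set_cvg_integral _ _ _ F f mu ndF mF
  (fun i => measurable_funTS mf) (fun i x _ => f0 x).
rewrite -(cvg_lim _ cvF)//; apply: lime_le; first exact/cvgP/cvF.
apply: nearW => i.
have [le|gt] := leP (inf S + i.+1%:R^-1) t.
  have i0 : 0 < i.+1%:R^-1 :> R by rewrite invr_gt0.
  have [x Sx xlt] := inf_adherent i0 Sinf.
  by case: (Sup x (inf S + i.+1%:R^-1) Sx) => //; rewrite le ltW.
by rewrite /F set_itv_ge ?integral_set0// bnd_simp -ltNge.
Qed.

Lemma ae_integralM_le (d : measure_display) (T : measurableType d)
    (R : realType) (mu : {measure set T -> \bar R}) (D : set T)
    (f g : T -> \bar R) (b : R) (e : \bar R) :
  measurable D -> measurable_fun setT f -> measurable_fun setT g ->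
  (forall x, 0 <= f x)%E -> (forall x, 0 <= g x)%E -> 0 <= b ->
  (\forall x \ae mu, D x -> g x <= b%:E)%E ->
  (\int[mu]_(x in D) f x <= e)%E ->
  (\int[mu]_(x in D) (f x * g x) <= b%:E * e)%E.
Proof.
move=> mD mf mg f0 g0 b0 gb fe.
apply: (@le_trans _ _ (\int[mu]_(x in D) (b%:E * f x))%E); last first.
  rewrite ge0_integralZl//; last exact: measurable_funTS.
  by rewrite lee_wpmul2l// lee_fin.
apply: ae_ge0_le_integral => //.
- by move=> x _; rewrite mule_ge0.
- by apply: measurable_funTS; exact: emeasurable_funM.
- by move=> x _; rewrite mule_ge0.
- by apply: measurable_funTS; exact: measurable_funeM.
- apply: filterS gb => x gb Dx; rewrite muleC lee_wpmul2r//; exact: gb.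
Qed.

(** * The induction on the number of iterations *)

(** The two summands are the contributions of the far part and of the last window of length [delta].
    With [c0 <= c * eps] they add up to at most [(n + 1) c (n c)^m eps^(n + 1)], and it remains to
    use [n <= n + 1] in the power. *)
Lemma bound_growth (R : realFieldType) (n m : nat) (c eps c0 : R) :
  0 < eps -> 1 <= c -> c0 <= c * eps ->
  (n%:R * c) ^+ m * eps ^+ n * c0 + (n%:R * c) ^+ m.+1 * eps ^+ n * eps
    <= (n.+1%:R * c) ^+ m.+1 * eps ^+ n.+1.
Proof.
move=> e0 c1 cc0.
have c_ge0 : 0 <= c by rewrite (le_trans ler01).
have B0 : 0 <= (n%:R * c) ^+ m * eps ^+ n.
  by rewrite mulr_ge0// exprn_ge0// ?mulr_ge0// ltW.
apply: (@le_trans _ _ ((n%:R * c) ^+ m * eps ^+ n * (c * eps) +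
   (n%:R * c) ^+ m.+1 * eps ^+ n * eps)).
  by rewrite lerD2r ler_wpM2l.
have -> : (n%:R * c) ^+ m * eps ^+ n * (c * eps) +
   (n%:R * c) ^+ m.+1 * eps ^+ n * eps =
   (n.+1%:R * c) * (n%:R * c) ^+ m * eps ^+ n.+1.
  by rewrite !exprS -natr1; ring.
rewrite ler_wpM2r ?exprn_ge0 ?(ltW e0)//.
rewrite exprS ler_wpM2l ?mulr_ge0// lerXn2r ?nnegrE ?mulr_ge0//.
by rewrite ler_wpM2r// ler_nat.
Qed.

(* Kernels are extended by zero off the triangle, so measurability and positivity
   may be assumed on the whole plane here. *)
Lemma window_int_iterated_le_total (R : realType) (I P : set R)
    (mu : {sigma_finite_measure set (measurableTypeR R) -> \bar R})
    (k : R -> R -> \bar R) (c0 eps delta : R) :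
  is_interval I ->
  measurable_fun [set: measurableTypeR R * measurableTypeR R]
    (fun ts => k ts.1 ts.2) ->
  (forall t s, 0 <= k t s)%E -> 0 < eps -> 0 < delta ->
  P `<=` I -> (\forall t \ae mu, P t) ->
  (forall t, P t -> below_int I mu k t <= c0%:E)%E ->
  (forall r t, P t -> window I delta (r, t) ->
    window_int mu k (r, t) <= eps%:E)%E ->
  let c := Num.max 1 (c0 / eps) in
  forall n m r t, P t -> window I (m.+1%:R * delta) (r, t) ->
  (window_int mu (iterated_kernel k mu n.+1) (r, t) <=
    ((n.+1%:R * c) ^+ m * eps ^+ n.+1)%:E)%E.
Proof.
move=> Iitv mk k0 e0 d0 PI aeP Hc0 Heps c.
have c1 : 1 <= c by rewrite /c le_max lexx.
have c_ge0 : 0 <= c by rewrite (le_trans ler01).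
have cc0 : c0 <= c * eps by rewrite -ler_pdivrMr// /c le_max lexx orbT.
have mI : measurable (I : set (measurableTypeR R)).
  exact: is_interval_measurable.
have mkt t : measurable_fun [set: measurableTypeR R] (k t).
  exact: (measurableT_comp mk (pair1_measurable t)).
have B0 n m : 0 <= (n%:R * c) ^+ m * eps ^+ n.
  by rewrite mulr_ge0// exprn_ge0// ?mulr_ge0// ltW.
have below (A : set (measurableTypeR R)) r t : measurable A -> P t -> I r ->
    A `<=` `[r, t]%classic -> (\int[mu]_(s in A) k t s <= c0%:E)%E.
  move=> mA Pt Ir Art; apply: le_trans (Hc0 t Pt); apply: ge0_subset_integral.
  - exact: mA.
  - have -> : [set s | I s /\ s <= t] = I `&` `]-oo, t]%classic.
      by apply/seteqP; split=> s /=; rewrite in_itv.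
    exact: measurableI.
  - exact: measurable_funTS.
  - by move=> *; exact: k0.
  - move=> s /Art; rewrite /= in_itv/= => /andP[rs st]; split => //.
    by apply: (Iitv r t) => //; [exact: PI|rewrite rs].
elim=> [|n IH] m r t Pt [/= Ir It /andP[rt trd]].
  (* Both indices are shifted by one. For the first iterate, a single window is the hypothesis
     [Heps]; for more windows the bound is [c0 <= c * eps], and [1 <= c] allows raising the power of
     [c]. *)
  rewrite expr1 mul1r; case: m trd => [|m] trd.
    by rewrite expr0 !mul1r in trd *; apply: Heps => //; split => //; rewrite rt.
  apply: (@le_trans _ _ c0%:E); first exact: (below _ r).
  rewrite lee_fin (le_trans cc0)// ler_wpM2r ?(ltW e0)//.
  by rewrite exprS ler_peMr// exprn_ege1.
rewrite window_int_iteratedS//.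
have mF : measurable_fun [set: measurableTypeR R]
    (fun u => window_int mu (iterated_kernel k mu n.+1) (r, u)).
  apply: measurable_window_int; first exact: measurable_iterated_kernel.
  by move=> *; exact: iterated_kernel_ge0.
have F0 u : (0 <= window_int mu (iterated_kernel k mu n.+1) (r, u))%E.
  by apply: integral_ge0 => s _; exact: iterated_kernel_ge0.
(* On a part [A] of [[r, t]] within [m'.+1] windows of [r], the induction hypothesis applies at
   every [u] in [P], hence at almost every [u]; the factor [e] bounds the remaining integral of
   [k t]. *)
have piece (A : set (measurableTypeR R)) (e : R) m' : measurable A ->
    A `<=` `[r, t]%classic -> (forall u, A u -> u <= r + m'.+1%:R * delta) ->
    (\int[mu]_(u in A) k t u <= e%:E)%E ->
    (\int[mu]_(u in A)
      (k t u * window_int mu (iterated_kernel k mu n.+1) (r, u)) <=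
     ((n.+1%:R * c) ^+ m' * eps ^+ n.+1 * e)%:E)%E.
  move=> mA Art Am Ae; rewrite EFinM; apply: ae_integralM_le => //.
  apply: (@filterS _ _ (ae_filter_ringOfSetsType mu) _ _ _ aeP) => u Pu Au.
  apply: IH => //; split => /=; [by []|exact: PI|].
  by have := Art _ Au; rewrite /= in_itv/= => /andP[-> _]; exact: Am.
have grow := bound_growth _ n.+1 _ c eps c0 e0 c1 cc0.
(* If [[r, t]] has length at most [delta], no cut is made: [k t] has integral at most [eps] over all
   of it. *)
have [tle|tgt] := leP t (r + delta).
  apply: le_trans (_ : ((n.+1%:R * c) ^+ m * eps ^+ n.+1 * eps)%:E <= _)%E.
    apply: piece => //.
    - by move=> u; rewrite /= in_itv/= => /andP[_ /le_trans]; apply.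
    - by apply: Heps => //; split => //=; rewrite rt.
  rewrite lee_fin -mulrA -exprSr ler_wpM2r ?exprn_ge0 ?(ltW e0)//.
  by rewrite lerXn2r ?nnegrE ?mulr_ge0// ler_wpM2r// ler_nat.
case: m trd => [|m] trd.
  by move: tgt; rewrite mul1r in trd; rewrite ltNge trd.
have Itd : I (t - delta).
  by apply: (Iitv r t) => //; rewrite lerBrDr ltW//= gerBl ltW.
(* Up to [t - delta] only [m.+1] windows are used and [k t] costs [c0]; on the last piece all [m.+2]
   windows are used but [k t] costs only [eps]. The first piece is half-open to keep the two
   disjoint, as [mu] may have atoms. *)
have -> : `[r, t]%classic =
    `[r, t - delta[%classic `|` `[t - delta, t]%classic :> set (measurableTypeR R).
  by rewrite -itv_bndbnd_setU// bnd_simp ?lerBrDr ?gerBl ltW.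
rewrite ge0_integral_setU//; last 3 first.
- by apply: measurable_funTS; exact: emeasurable_funM.
- by move=> u _; rewrite mule_ge0.
- apply/disj_setPS => u [] /=; rewrite !in_itv/= => /andP[_ ut] /andP[tu _].
  by move: tu; rewrite leNgt ut.
apply: le_trans (_ : _ <= ((n.+1%:R * c) ^+ m * eps ^+ n.+1 * c0 +
    (n.+1%:R * c) ^+ m.+1 * eps ^+ n.+1 * eps)%:E)%E _; last first.
  by rewrite lee_fin; exact: grow m.
rewrite EFinD; apply: leeD.
- apply: piece => //.
  + by move=> u; rewrite /= !in_itv/= => /andP[-> /ltW/le_trans->]//; rewrite gerBl ltW.
  + move=> u; rewrite /= in_itv/= => /andP[_ /ltW/le_trans]; apply.
    by move: trd; rewrite -[m.+2]addn1 natrD mulrDl mul1r addrA -lerBlDr.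
  + apply: (below _ r) => //.
    by move=> u; rewrite /= !in_itv/= => /andP[-> /ltW/le_trans->]//; rewrite gerBl ltW.
- apply: piece => //.
  + move=> u; rewrite /= !in_itv/= => /andP[tu ->]; rewrite andbT (le_trans _ tu)//.
    by rewrite lerBrDr ltW.
  + by move=> u; rewrite /= in_itv/= => /andP[_ /le_trans]; apply.
  + by apply: Heps => //; split => //=; rewrite subrK gerBl ltW/=.
Qed.

(** * Kernels on the triangle, right limits and essential suprema *)

(** For [s <= u <= t] with [s], [t] in [I], convexity puts [u] in [I], so the recursion never leaves
    the triangle. This permits replacing a kernel by its extension by zero. *)
Lemma eq_iterated_kernel (R : realType) (I : set R)
    (mu : {measure set (measurableTypeR R) -> \bar R})
    (k l : R -> R -> \bar R) (n : nat) (t s : R) :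
  is_interval I ->
  (forall t s, triangle I (t, s) -> k t s = l t s) ->
  triangle I (t, s) -> iterated_kernel k mu n t s = iterated_kernel l mu n t s.
Proof.
move=> Iitv kl; elim: n t s => [|[|n] IH] t s; [exact: kl|exact: kl|].
move=> [/= It Is st]; rewrite !iterated_kernelS//.
apply: eq_integral => u; rewrite inE /= in_itv/= => /andP[su ut].
have Iu : I u by apply: (Iitv s t) => //; rewrite su.
by rewrite kl// IH.
Qed.

Lemma eq_window_int (R : realType) (I : set R)
    (mu : {measure set (measurableTypeR R) -> \bar R})
    (k l : R -> R -> \bar R) (r t : R) :
  is_interval I ->
  (forall t s, triangle I (t, s) -> k t s = l t s) ->
  I r -> I t -> window_int mu k (r, t) = window_int mu l (r, t).
Proof.
move=> Iitv kl Ir It; apply: eq_integral => s.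
rewrite inE /= in_itv/= => /andP[rs st]; apply: kl; split => //=.
by apply: (Iitv r t) => //; rewrite rs.
Qed.

(** Monotonicity makes [lim] a genuine limit, equal to the infimum of [f] over []a, +oo[]. This is
    where [delta] comes from. *)
Lemma lim_at_right_lt (R : realType) (f : R -> \bar R) (a : R) (e : \bar R) :
  {homo f : x y / x <= y >-> (x <= y)%E} ->
  (lim (f x @[x --> a^'+]) < e)%E -> exists2 x, a < x & (f x < e)%E.
Proof.
move=> ndf.
have cvf : f x @[x --> a^'+] --> ereal_inf [set f x | x in `]a, +oo[].
  apply: nondecreasing_at_right_cvge; first by rewrite bnd_simp.
  by move=> x y _ _; exact: ndf.
rewrite (cvg_lim _ cvf)// => /ereal_inf_lt[_ [x /= + <-] xe].
by rewrite in_itv/= andbT => ax; exists x.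
Qed.

(** The maximum with 0 and the value 0 of the restriction off [D] both stay below a nonnegative
    [b]. *)
Lemma ess_sup_on_leP (d : measure_display) (T : measurableType d)
    (R : realType) (mu : {measure set T -> \bar R}) (D : set T)
    (f : T -> \bar R) (b : \bar R) :
  (0 <= b)%E ->
  (ess_sup_on mu D f <= b)%E <-> \forall x \ae mu, D x -> (f x <= b)%E.
Proof.
move=> b0; rewrite /ess_sup_on ge_max b0/=; split => [/ess_supP|] H.
  by apply: filterS H => x + Dx; rewrite patchE mem_set.
apply/ess_supP; apply: filterS H => x fb.
by rewrite patchE; case: ifPn => // /set_mem.
Qed.

Lemma window_subset (R : realType) (I : set R) (d1 d2 : R) :
  d1 <= d2 -> window I d1 `<=` window I d2.
Proof.
move=> d12 [r t] [/= Ir It /andP[rt trd]]; split => //=.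
by rewrite rt (le_trans trd)// lerD2l.
Qed.

Lemma sup_window_homo (R : realType) (I : set R)
    (mu : {measure set (measurableTypeR R) -> \bar R}) (k : R -> R -> \bar R) :
  {homo sup_window I mu k : d1 d2 / d1 <= d2 >-> (d1 <= d2)%E}.
Proof.
move=> d1 d2 d12; apply: ereal_sup_le; apply: image_subset.
exact: window_subset.
Qed.

Lemma ess_sup_window_homo (R : realType) (I : set R)
    (mu : {sigma_finite_measure set (measurableTypeR R) -> \bar R})
    (k : R -> R -> \bar R) :
  {homo ess_sup_window I mu k : d1 d2 / d1 <= d2 >-> (d1 <= d2)%E}.
Proof.
move=> d1 d2 d12; have ge0 : (0 <= ess_sup_window I mu k d2)%E.
  by rewrite /ess_sup_window /ess_sup_on le_max lexx.
apply/ess_sup_on_leP => //.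
have /(ess_sup_on_leP _ _ _ _ _ _ _ ge0) := lexx (ess_sup_window I mu k d2).
by apply: filterS => z + /(window_subset _ _ _ _ d12) => /[apply].
Qed.

Lemma measurable_triangle (R : realType) (I : set R) :
  is_interval I -> measurable (triangle I).
Proof.
move=> Iitv; have mI : measurable (I : set (measurableTypeR R)).
  exact: is_interval_measurable.
rewrite (_ : triangle I = (I `*` I) `&` (setT `&` [set ts | snd ts <= fst ts])).
  by apply: measurableI; [exact: measurableX|exact: measurable_fun_le].
by rewrite setTI; apply/seteqP; split => ts /=; [case|case=> -[]].
Qed.

(** The form shared by both versions of the estimate. The extension by zero [l] is measurable and
    nonnegative on the whole plane, and every integral involved sees only the triangle, where [l]
    agrees with [k]. *)
Lemma window_int_iterated_le (R : realType) (I P : set R) (k : R -> R -> \bar R)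
    (mu : {sigma_finite_measure set (measurableTypeR R) -> \bar R})
    (c0 eps delta : R) :
  is_interval I -> nonneg_kernel I k -> 0 < eps -> 0 < delta ->
  P `<=` I -> (\forall t \ae mu, P t) ->
  (forall t, P t -> below_int I mu k t <= c0%:E)%E ->
  (forall r t, P t -> window I delta (r, t) ->
    window_int mu k (r, t) <= eps%:E)%E ->
  forall m n r t, (0 < m)%N -> (0 < n)%N -> P t ->
  window I (m%:R * delta) (r, t) ->
  (window_int mu (iterated_kernel k mu n) (r, t) <=
    ((n%:R * Num.max 1 (c0 / eps)) ^+ m.-1 * eps ^+ n)%:E)%E.
Proof.
move=> Iitv [mk k0] e0 d0 PI aeP Hc0 Heps [//|m] [//|n] r t _ _ Pt Wrt.
pose l t s := ((fun ts => k ts.1 ts.2) \_ (triangle I)) (t, s).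
have kl t' s' : triangle I (t', s') -> k t' s' = l t' s'.
  by move=> ts; rewrite /l patchE mem_set.
have ml : measurable_fun [set: measurableTypeR R * measurableTypeR R]
    (fun ts => l ts.1 ts.2).
  under eq_fun do rewrite /l -surjective_pairing.
  by apply: (measurable_restrictT _ _).1 => //; exact: measurable_triangle.
have l0 t' s' : (0 <= l t' s')%E.
  by rewrite /l patchE; case: ifPn => // /set_mem /k0.
have [Ir It _] := Wrt.
rewrite (eq_window_int _ I mu _ (iterated_kernel l mu n.+1))//; last first.
  by move=> t2 s2 ts; apply: (eq_iterated_kernel _ I).
apply: (window_int_iterated_le_total _ I P mu l c0 eps delta) => //.
- move=> t' Pt'; rewrite (le_trans _ (Hc0 t' Pt'))// le_eqVlt; apply/orP; left.
  apply/eqP/eq_integral => s; rewrite inE /= => -[Is st].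
  by rewrite kl//; split => //; exact: PI.
- move=> r' t' Pt' W; rewrite -(eq_window_int _ I mu k)//; first exact: Heps.
    by case: W.
  by case: W.
Qed.

Lemma nonneg_kernel_pow (R : realType) (I : set R) (k : R -> R -> \bar R) (p : R) :
  nonneg_kernel I k -> nonneg_kernel I (kernel_pow k p).
Proof.
move=> [mk k0]; split; last by move=> *; exact: poweR_ge0.
exact: (measurableT_comp (measurable_poweR p) mk).
Qed.

(** * From almost every pair to almost every [t] and all [r] *)

(** Taking sections of the exceptional null set gives, for almost every [t], the bound for almost
    every [r]; monotonicity in [r] then gives it for every [r] in the window. *)
Lemma ae_sections_window_int_le (R : realType) (I : set R)
    (mu : {sigma_finite_measure set (measurableTypeR R) -> \bar R})
    (k : R -> R -> \bar R) (delta : R) (e : \bar R) :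
  is_interval I -> nonneg_kernel I k -> (0 <= e)%E ->
  (ess_sup_window I mu k delta <= e)%E ->
  \forall t \ae mu, forall r, window I delta (r, t) ->
    (window_int mu k (r, t) <= e)%E.
Proof.
move=> Iitv [mk k0] e0 /(ess_sup_on_leP _ _ _ _ _ _ _ e0) /ae_ysection.
apply: (@filterS _ _ (ae_filter_ringOfSetsType mu)) => t aer r.
move=> [/= Ir It /andP[rt trd]].
(* The section [k t] is controlled only inside the triangle; cutting it to [[r, t]] gives a function
   measurable and nonnegative on the whole line. *)
pose f := (fun s => k t s) \_ `[r, t].
have fE r' : r <= r' -> window_int mu k (r', t) = (\int[mu]_(s in `[r', t]) f s)%E.
  move=> rr'; apply: eq_integral => s; rewrite inE /= in_itv/= => /andP[r's st].
  by rewrite /f patchE mem_set//= in_itv/= (le_trans rr').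
have Itri s : r <= s <= t -> triangle I (t, s).
  move=> rst; split => //=; last by case/andP: rst.
  exact: (Iitv r t).
rewrite fE//; apply: ae_integral_itv_le => //.
- apply: (measurable_restrictT _ _).1 => //.
  have mT := measurable_triangle _ _ Iitv.
  have := measurable_restrictT (fun ts => k ts.1 ts.2) mT.
  move=> /iffLR /(_ mk) mkT.
  have /measurable_funTS := measurableT_comp mkT (pair1_measurable t).
  move=> /(_ `[r, t]%classic); apply: eq_measurable_fun => s.
  by rewrite inE /= in_itv/= => /Itri ts; rewrite patchE mem_set.
- move=> s; rewrite /f patchE; case: ifPn => // /set_mem.
  by rewrite /= in_itv/= => /Itri /k0.
(* Moving [r] to the right within [[r, t]] keeps the pair in the window, so the almost everywhere
   bound is available at [r']. *)
- apply: (@filterS _ _ (ae_filter_ringOfSetsType mu) _ _ _ aer) => r' + /andP[rr' r't].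
  rewrite -fE//; apply; split => //=.
    by have [] := Itri r' ltac:(by rewrite rr').
  by rewrite r't (le_trans trd)// lerD2r.
Qed.

(** * The versions with suprema and with essential suprema *)

Theorem proposition4p1 (R : realType) (I : set R)
    (hI : nondegenerate_interval I)
    (k : R -> R -> \bar R) (hk : nonneg_kernel I k)
    (mu : {sigma_finite_measure set (measurableTypeR R) -> \bar R})
    (hmu : mu (~` I) = 0%E)
    (p : R) (hp : 0 < p) :
  (let c0 := sup_below I mu (kernel_pow k p) in
   let eps0 := lim (sup_window I mu (kernel_pow k p) d @[d --> 0^'+]) in
   c0 \is a fin_num -> eps0 \is a fin_num ->
   forall eps : R, (eps0 < eps%:E)%E ->
   let c := Num.max 1 (fine c0 / eps) in
   exists delta : R, 0 < delta /\
     forall m n : nat, (0 < m)%N -> (0 < n)%N ->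
       (sup_window I mu (iterated_kernel (kernel_pow k p) mu n) (m%:R * delta)
        <= ((n%:R * c) ^+ m.-1 * eps ^+ n)%:E)%E)
  /\
  (let c0 := ess_sup_below I mu (kernel_pow k p) in
   let eps0 := lim (ess_sup_window I mu (kernel_pow k p) d @[d --> 0^'+]) in
   c0 \is a fin_num -> eps0 \is a fin_num ->
   forall eps : R, (eps0 < eps%:E)%E ->
   let c := Num.max 1 (fine c0 / eps) in
   exists delta : R, 0 < delta /\
     forall m n : nat, (0 < m)%N -> (0 < n)%N ->
       (ess_sup_window I mu (iterated_kernel (kernel_pow k p) mu n)
          (m%:R * delta)
        <= ((n%:R * c) ^+ m.-1 * eps ^+ n)%:E)%E).
Proof.
have /(_ p) hK := nonneg_kernel_pow _ _ _ _ hk.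
set K := kernel_pow k p in hK *.
have [Iitv [a [_ [Ia _ _]]]] := hI.
have mI : measurable (I : set (measurableTypeR R)).
  exact: is_interval_measurable.
have aeI : \forall t \ae mu, I t.
  by exists (~` I); split => //; exact: measurableC.
split=> c0 eps0 c0fin eps0fin eps eps0_lt c.
- have [delta d0 dlt] := lim_at_right_lt _ _ _ _ (sup_window_homo _ I mu K) eps0_lt.
  have win r t : window I delta (r, t) -> (window_int mu K (r, t) <= eps%:E)%E.
    move=> W; apply: le_trans (ltW dlt).
    by apply: ereal_sup_ubound; exists (r, t).
  (* The degenerate pair [(a, a)] lies in the window, so the supremum is at least a nonnegative
     integral. *)
  have e0 : 0 < eps.
    rewrite -lte_fin; apply: le_lt_trans dlt.
    apply: (@le_trans _ _ (window_int mu K (a, a))).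
      by apply: integral_ge0 => s _; exact: poweR_ge0.
    apply: ereal_sup_ubound; exists (a, a) => //; split => //=.
    by rewrite lexx lerDl ltW.
  exists delta; split => // m n m0 n0.
  apply: ge_ereal_sup => _ [[r t] W <-].
  (* With true suprema every point of [I] is good, so [P] is [I]. *)
  apply: (window_int_iterated_le _ I I K mu (fine c0) eps delta) => //.
    move=> t' It'; rewrite fineK//.
    by apply: ereal_sup_ubound; exists t'.
    by move=> r2 t2 _; exact: win.
  by case: W.
- have [delta d0 dlt] :=
    lim_at_right_lt _ _ _ _ (ess_sup_window_homo _ I mu K) eps0_lt.
  (* Here positivity comes from the maximum with 0 in [ess_sup_on]. *)
  have e0 : 0 < eps.
    rewrite -lte_fin; apply: le_lt_trans dlt.
    by rewrite /ess_sup_window /ess_sup_on le_max lexx.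
  have e0E : (0 <= eps%:E)%E by rewrite lee_fin ltW.
  have aeW := ae_sections_window_int_le _ I mu K delta _ Iitv hK e0E (ltW dlt).
  have c0ge0 : (0 <= c0)%E by rewrite /c0 /ess_sup_below /ess_sup_on le_max lexx.
  have /(ess_sup_on_leP _ _ _ _ _ _ _ c0ge0) aeB := lexx c0.
  (* The good points: the bounds hold at [t] itself, the second one for all [r] simultaneously.
     Three almost sure conditions intersect to a set with null complement. *)
  pose P := [set t | [/\ I t, (below_int I mu K t <= c0)%E &
    forall r, window I delta (r, t) -> (window_int mu K (r, t) <= eps%:E)%E]].
  have aeP : \forall t \ae mu, P t.
    have FF := ae_filter_ringOfSetsType mu.
    apply: (@filterS3 _ _ FF _ _ _ _ _ aeI aeB aeW) => t It Bt Wt.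
    by split => //; exact: Bt.
  exists delta; split => // m n m0 n0.
  have c1 : 1 <= c by rewrite /c le_max lexx.
  apply/ess_sup_on_leP.
    by rewrite lee_fin mulr_ge0// exprn_ge0// ?mulr_ge0 ?(ltW e0)// (le_trans ler01).
  (* Goodness concerns only the second coordinate, so almost every pair [(r, t)] has [t] in [P]. *)
  have := ae_prod_snd _ _ _ _ _ mu mu _ aeP.
  apply: filterS => -[r t]/= Pt W.
  apply: (window_int_iterated_le _ I P K mu (fine c0) eps delta) => //.
  + by move=> ? [].
  + by move=> t' [_ + _]; rewrite fineK.
  + by move=> r' t' [_ _]; exact.
Qed.
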